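(* Let $G=(V,E)$ be a directed graph, let $T_1,\dots,T_k\subseteq V$ be terminal sets, let $F\subseteq E$ be a set of undeletable edges, and let $p\ge 0$ be an integer. Let $e\in E\setminus F$ be an edge whose tail is reachable from $T_1$ by a directed path all of whose edges lie in $F$ (possibly the empty path), and whose head lies outside $T_1$. Suppose that the minimum size of a $(T_1, T_2\cup\dots\cup T_k)$-separator with undeletable edges $F$ equals the minimum size of a $(T_1, T_2\cup\dots\cup T_k)$-separator with undeletable edges $F\cup\{e\}$, and that this common size is at most $p$. Then the minimum size of a linear cut for $\langle T_1,\dots,T_k\rangle$ in $G$ with undeletable edges $F$ equals the minimum size of a linear cut for $\langle T_1,\dots,T_k\rangle$ in $G$ with undeletable edges $F\cup\{e\}$.
   Context: For $X,Y\subseteq V$ and $F\subseteq E$, an $(X,Y)$-separator with undeletable edges $F$ is a set $S\subseteq E\setminus F$ such that every directed path from a vertex of $X$ to a vertex of $Y$ uses an edge of $S$. A linear cut for the tuple $\langle T_1,\dots,T_k\rangle$ with undeletable edges $F$ is a set $S\subseteq E\setminus F$ such that in $(V,E\setminus S)$ there is no directed path from a vertex of $T_i$ to a vertex of $T_j$ whenever $i<j$. *)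

(* Defs.v *)
From mathcomp Require Import all_boot.

Set Implicit Arguments.
Unset Strict Implicit.
Unset Printing Implicit Defensive.

(* A finite digraph on V is its edge set E : {set V * V}; the edge (u, v) has
   tail u and head v. *)

(* The directed path visits x, then the vertices of q in order, and ends at y;
   q = [::] is the empty path from x to x. *)
Definition dipath (V : finType) (E : {set V * V}) (x y : V) (q : seq V) : bool :=
  [&& path (fun u v => (u, v) \in E) x q, uniq (x :: q) & last x q == y].

Definition path_edges (V : finType) (x : V) (q : seq V) : seq (V * V) :=
  pairmap pair x q.

Definition reachable (V : finType) (E : {set V * V}) (x y : V) : Prop :=
  exists q : seq V, dipath E x y q.

Definition separator (V : finType) (E : {set V * V}) (X Y : {set V})
    (F S : {set V * V}) : Prop :=
  S \subset E :\: F /\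
  forall (x y : V) (q : seq V), x \in X -> y \in Y -> dipath E x y q ->
    exists2 a : V * V, a \in path_edges x q & a \in S.

Definition linear_cut (V : finType) (E : {set V * V}) (k : nat)
    (T : 'I_k -> {set V}) (F S : {set V * V}) : Prop :=
  S \subset E :\: F /\
  forall (i j : 'I_k) (x y : V), i < j -> x \in T i -> y \in T j ->
    ~ reachable (E :\: S) x y.

(* n is the minimum size of a set satisfying P.  When no set satisfies P, no n
   does: the minimum is then infinite. *)
Definition is_min_size (A : finType) (P : {set A} -> Prop) (n : nat) : Prop :=
  (exists2 S : {set A}, P S & #|S| = n) /\
  forall S : {set A}, P S -> n <= #|S|.

(* Equality of minimum sizes in nat extended with infinity: either both minima
   exist and agree, or neither exists. *)
Definition same_min_size (A : finType) (P Q : {set A} -> Prop) : Prop :=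
  forall n : nat, is_min_size P n <-> is_min_size Q n.

(* Main.v *)
(* Let R' be the set reachable from T_1 after deleting a minimum separator that
   avoids e; both ends of e lie in R'.  Given a linear cut S, let R be the set
   reachable from T_1 in E \ S, and replace the edges of S with tail in
   A := R :|: R' by the boundary of A.  Since A misses T_2, ..., T_k, the result
   is again a linear cut, and it avoids e.  The boundary of R :&: R' is a
   separator, hence at least as large as that of R', so submodularity bounds the
   boundary of A by that of R, which is part of S: the new cut is not larger. *)
Require Import Defs.
From mathcomp Require Import all_boot.

Set Implicit Arguments.
Unset Strict Implicit.
Unset Printing Implicit Defensive.

Section Boundary.
Variables (V : finType) (E : {set V * V}).
Implicit Types (A B X Y : {set V}) (F S : {set V * V}).

Definition boundary A := [set a in E | (a.1 \in A) && (a.2 \notin A)].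

(** By [cardsUI] each side is the size of a union plus the size of an intersection. The unions and
    the intersections then compare by inclusion, one edge at a time. *)
Lemma boundary_submod A B :
  #|boundary (A :|: B)| + #|boundary (A :&: B)|
    <= #|boundary A| + #|boundary B|.
Proof.
rewrite -cardsUI -[leqRHS]cardsUI.
apply: leq_add; apply/subset_leq_card/subsetP=> a; rewrite !inE;
  by case: (a \in E) (a.1 \in A) (a.1 \in B) (a.2 \in A) (a.2 \in B)
    => [] [] [] [] [].
Qed.

Lemma boundaryU_sub A B : boundary (A :|: B) \subset boundary A :|: boundary B.
Proof.
apply/subsetP=> a; rewrite !inE.
by case: (a \in E) (a.1 \in A) (a.1 \in B) (a.2 \in A) (a.2 \in B)
  => [] [] [] [] [].
Qed.

Lemma boundaryI_sub A B : boundary (A :&: B) \subset boundary A :|: boundary B.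
Proof.
apply/subsetP=> a; rewrite !inE.
by case: (a \in E) (a.1 \in A) (a.1 \in B) (a.2 \in A) (a.2 \in B)
  => [] [] [] [] [].
Qed.

Lemma path_crosses_boundary A x q :
  path (fun u v => (u, v) \in E) x q -> x \in A -> last x q \notin A ->
  exists2 a, a \in path_edges x q & a \in boundary A.
Proof.
elim: q x => [|y q IHq] x /=; first by move=> _ ->.
case/andP=> Exy Eq xA lastA; have [yA | yA] := boolP (y \in A).
  by have [a aq aA] := IHq y Eq yA lastA; exists a; rewrite // inE aq orbT.
by exists (x, y); rewrite !inE ?eqxx ?Exy ?xA.
Qed.

Lemma boundary_separator F X Y A :
  X \subset A -> [disjoint A & Y] -> boundary A \subset E :\: F ->
  separator E X Y F (boundary A).
Proof.
move=> XA AY sAF; split=> // x y q xX yY /and3P[Eq _ /eqP lq].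
apply: path_crosses_boundary => //; first exact: subsetP xX.
by rewrite lq; apply: contraTN yY => /(disjointFr AY) ->.
Qed.

(** The boolean [connect] allows a set comprehension; [reach_setP] passes to the simple paths of
    [reachable] by shortening walks. *)
Definition reach_set S X :=
  [set v | [exists x in X, connect (fun u v => (u, v) \in E :\: S) x v]].

Lemma sub_reach_set S X : X \subset reach_set S X.
Proof. by apply/subsetP=> x xX; rewrite inE; apply/exists_inP; exists x. Qed.

Lemma reach_set_step S X a :
  a \in E :\: S -> a.1 \in reach_set S X -> a.2 \in reach_set S X.
Proof.
case: a => u v uvE; rewrite !inE => /exists_inP[x xX xu].
by apply/exists_inP; exists x => //; apply: connect_trans xu (connect1 _).
Qed.

Lemma boundary_reach_set S X : boundary (reach_set S X) \subset S.
Proof.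
apply/subsetP=> a; rewrite inE => /and3P[aE aR]; apply: contraR => aS.
by apply: reach_set_step aR; rewrite inE aS.
Qed.

Lemma reach_setP S X v :
  reflect (exists2 x, x \in X & reachable (E :\: S) x v) (v \in reach_set S X).
Proof.
rewrite inE; apply: (iffP exists_inP) => -[x xX].
  case/connectP=> q Eq ->; case/shortenP: Eq => q' Eq' Uq' _.
  by exists x => //; exists q'; rewrite /dipath Eq' Uq' eqxx.
case=> q /and3P[Eq _ /eqP <-]; exists x => //.
by apply/connectP; exists q.
Qed.

Lemma path_edges_in S x q a :
  path (fun u v => (u, v) \in S) x q -> a \in path_edges x q -> a \in S.
Proof.
elim: q x => //= y q IHq x /andP[Sxy Sq]; rewrite inE => /predU1P[-> //|].
exact: IHq.
Qed.

Lemma separator_reach_set F S X Y :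
  separator E X Y F S -> [disjoint reach_set S X & Y].
Proof.
case=> _ sepS; rewrite disjoint_subset; apply/subsetP=> y /reach_setP[x xX].
case=> q /and3P[ESq Uq lq]; apply/negP=> yY.
have Eq : dipath E x y q.
  by rewrite /dipath Uq lq (sub_path _ ESq) // => u v /setDP[].
have [a /(path_edges_in ESq)] := sepS x y q xX yY Eq.
by rewrite inE => /andP[/negP].
Qed.

Lemma path_closed S A x q :
  boundary A \subset S -> path (fun u v => (u, v) \in E :\: S) x q ->
  x \in A -> last x q \in A.
Proof.
move=> sAS ESq xA; apply: contraT => lA.
have Eq : path (fun u v => (u, v) \in E) x q.
  by apply: sub_path ESq => u v /setDP[].
have [a /(path_edges_in ESq) + /(subsetP sAS)] :=
  path_crosses_boundary Eq xA lA.
by rewrite inE => /andP[/negP].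
Qed.

Lemma linear_cut_reach_set k (T : 'I_k.+1 -> {set V}) F S :
  linear_cut E T F S ->
  [disjoint reach_set S (T ord0) & \bigcup_(i | i != ord0) T i].
Proof.
case=> _ cutS; rewrite disjoint_subset; apply/subsetP=> y /reach_setP[x x0 xy].
apply/negP=> /bigcupP[j j0 yj]; apply: cutS x0 yj xy.
by rewrite lt0n.
Qed.

Definition push_cut S A := boundary A :|: [set a in S | a.1 \notin A].

(** A surviving path cannot leave [A], whose boundary is deleted. If it ends in a later terminal
    set, hence outside [A], all its vertices lie outside [A]; there the new cut agrees with [S], so
    the path already survives [S]. *)
Lemma linear_cut_push k (T : 'I_k.+1 -> {set V}) F F' S A :
  linear_cut E T F S -> T ord0 \subset A ->
  [disjoint A & \bigcup_(i | i != ord0) T i] -> push_cut S A \subset E :\: F' ->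
  linear_cut E T F' (push_cut S A).
Proof.
case=> _ cutS T0A AY sub; split=> // i j x y ltij xi yj [q].
have j0 : j != ord0 by rewrite -lt0n (leq_ltn_trans _ ltij).
have yA : y \notin A.
  by apply/negP=> /(disjointFr AY) /negP[]; apply/bigcupP; exists j.
move=> /and3P[ESq Uq /eqP lq].
apply: (cutS i j x y ltij xi yj); exists q; rewrite /dipath Uq lq eqxx !andbT.
elim: q x {xi Uq} ESq lq => //= z q IHq x /andP[Exz ESq] lq.
rewrite IHq // andbT.
have zA : z \notin A.
  by apply: contra yA; rewrite -lq; apply: path_closed ESq; apply: subsetUl.
by move: Exz; rewrite !inE /= zA !andbT; case: (x \in A) (_ \in S) (_ \in E)
  => [] [] [].
Qed.

(** Edges of [boundary B] have their tails in [A], so none is among the edges kept from [S]: these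
    fit in [S] minus [boundary B], and [boundary B] pays for [boundary A]. *)
Lemma card_push_cut S A B :
  boundary B \subset S -> B \subset A -> #|boundary A| <= #|boundary B| ->
  #|push_cut S A| <= #|S|.
Proof.
move=> BS BA leAB; rewrite -(cardsID (boundary B) S) (setIidPr BS).
apply: leq_trans (leq_card_setU _ _) (leq_add leAB _).
apply/subset_leq_card/subsetP=> a; rewrite !inE => /andP[-> aA].
by rewrite andbT; apply: contra aA => /and3P[_ /(subsetP BA)].
Qed.

End Boundary.

(** Feasibility passes both ways, so the infinite case is covered too. *)
Lemma same_min_size_dominated (A : finType) (P Q : {set A} -> Prop) :
  (forall S, Q S -> P S) ->
  (forall S, P S -> exists2 S', Q S' & #|S'| <= #|S|) -> same_min_size P Q.
Proof.
move=> QP PQ n; split=> -[[S PS nS] minS].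
  have [S' QS' leS'] := PQ S PS; split=> [|S1 /QP/minS //].
  by exists S' => //; apply/eqP; rewrite eqn_leq (minS _ (QP _ QS')) -nS leS'.
split; first by exists S; [apply: QP|].
by move=> S1 /PQ[S2 /minS le2]; apply: leq_trans.
Qed.

Theorem theorem2 (V : finType) (E : {set V * V}) (k : nat)
    (T : 'I_k.+1 -> {set V}) (F : {set V * V}) (p : nat) (e : V * V)
    (hF : F \subset E)
    (he : e \in E :\: F)
    (htail : exists2 x : V, x \in T ord0 & reachable F x e.1)
    (hhead : e.2 \notin T ord0)
    (hsep : same_min_size
       (separator E (T ord0) (\bigcup_(i | i != ord0) T i) F)
       (separator E (T ord0) (\bigcup_(i | i != ord0) T i) (e |: F)))
    (hp : exists2 m : nat,
       is_min_size (separator E (T ord0) (\bigcup_(i | i != ord0) T i) F) m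
       & m <= p) :
  same_min_size (linear_cut E T F) (linear_cut E T (e |: F)).
Proof.
apply: same_min_size_dominated => [S [sub cutS] | S linS].
  by split=> //; apply: subset_trans sub _; rewrite setDS ?subsetUr.
have [m minF _] := hp; have [_ minm] := minF.
(* Equality of the separator minima yields a separator that avoids [e] and still has the minimum
   size [m] for [F]. *)
have [[S' sepS' cardS'] _] := (hsep m).1 minF.
set X := T ord0 in htail minm sepS' *.
set Y := \bigcup_(i | _) _ in minm sepS'.
have sS'E := sepS'.1; have sSE := linS.1.
have sS'F : S' \subset E :\: F.
  by apply: subset_trans sS'E _; rewrite setDS ?subsetUr.
pose R := reach_set E S X; pose R' := reach_set E S' X.
have bR : boundary E R \subset S := boundary_reach_set E S X.
have bR' : boundary E R' \subset S' := boundary_reach_set E S' X.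
have RY : [disjoint R & Y] := linear_cut_reach_set linS.
have R'Y : [disjoint R' & Y] := separator_reach_set sepS'.
have XR : X \subset R := sub_reach_set E S X.
have XR' : X \subset R' := sub_reach_set E S' X.
have sSS' : boundary E R :|: boundary E R' \subset E :\: F.
  by rewrite subUset (subset_trans bR) ?(subset_trans bR').
have eS' : e \notin S'.
  by apply/negP=> /(subsetP sS'E); rewrite !inE eqxx.
(* The path in [F] to the tail of [e] survives the deletion of [S'], which misses [F]. *)
have e1R' : e.1 \in R'.
  apply/reach_setP; have [x xX [q /and3P[Fq Uq lq]]] := htail.
  exists x => //; exists q; rewrite /dipath Uq lq !andbT.
  apply: sub_path Fq => u v uvF; rewrite inE (subsetP hF) // andbT.
  by apply/negP=> /(subsetP sS'F); rewrite inE uvF.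
have e2R' : e.2 \in R'.
  by apply: reach_set_step e1R'; case/setDP: he => eE _; rewrite inE eS'.
exists (push_cut E S (R :|: R')).
  apply: linear_cut_push linS _ _ _.
  - exact: subset_trans XR (subsetUl _ _).
  - by rewrite -setI_eq0 setIUl setU_eq0 !setI_eq0 RY.
  apply/subsetP=> a ha; rewrite in_setD in_setU1 negb_or -andbA.
  apply/andP; split.
    (* With both ends in [R :|: R'], [e] neither crosses the boundary nor is kept from [S]. *)
    apply: contraTneq ha => ->.
    by rewrite !(in_setU, in_set _ e) e1R' e2R' !orbT !andbF.
  rewrite -in_setD; case/setUP: ha => [ha|].
    by apply: (subsetP sSS'); apply: (subsetP (boundaryU_sub E R R')).
  by rewrite inE => /andP[/(subsetP sSE)].
apply: card_push_cut bR (subsetUl _ _) _.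
(* Adding this term lets submodularity reduce the goal to comparing the boundaries of [R'] and
   [R :&: R'], with [m] in between. *)
rewrite -(leq_add2r #|boundary E R'|).
apply: leq_trans (boundary_submod E R R'); rewrite leq_add2l.
apply: leq_trans (subset_leq_card bR') _; rewrite cardS'; apply: minm.
apply: boundary_separator.
- by rewrite subsetI XR.
- exact: disjointWl (subsetIl _ _) RY.
- exact: subset_trans (boundaryI_sub E R R') sSS'.
Qed.
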